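(* Let $0<a<b$ be real numbers and let $f$ be a real valued function such that $f'''$ exists and is continuous in some open interval containing $[a,b]$ and has no zeros in $[a,b]$. Let $P_{c}$ denote the Taylor polynomial to $f$ of order $2$ at $x=c$. Let $x_{1}\pm iy_{1}$ (with $x_1,y_1\in\mathbb{R}$, $y_1\ne 0$) denote the two roots of $P_{b}-P_{a}$, which are nonreal. Then $$x_{1}=\frac{\int_{a}^{b}t f'''(t)\,dt}{\int_{a}^{b}f'''(t)\,dt}$$ and thus $a<x_{1}<b$.
   Context: The Taylor polynomial to $f$ of order $2$ at $c$ is $P_c(z)=\sum_{k=0}^{2}\frac{f^{(k)}(c)}{k!}(z-c)^k$, regarded as a polynomial in the complex variable $z$. Under the stated hypotheses $P_b-P_a$ is a real quadratic polynomial with no real zeros. *)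

(* Defs.v *)
From Stdlib Require Import Reals Factorial.
From Coquelicot Require Import Coquelicot.

Open Scope R_scope.

(* [f] has three derivatives on the open interval ]l, u[ and the third one is
   continuous there.  All orders up to 3 are required because [Derive_n] is
   total: [ex_derive_n f 3 x] alone does not say that the lower-order
   derivatives exist near [x]. *)
Definition C3_on (f : R -> R) (l u : Rbar) : Prop :=
  forall x : R, Rbar_lt l x -> Rbar_lt x u ->
    (forall k : nat, (k <= 3)%nat -> ex_derive_n f k x) /\
    continuous (Derive_n f 3) x.

Definition taylor_poly (f : R -> R) (n : nat) (c : R) (z : C) : C :=
  sum_n (fun k : nat =>
    (RtoC (Derive_n f k c / INR (fact k)) * (z - RtoC c) ^ k)%C) n.

(* Main.v *)
(* Since d/dc P_c(z) = f'''(c) (z - c)^2 / 2, the difference P_b - P_a is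
   1/2 int_a^b f'''(t) (z - t)^2 dt = (m0 z^2 - 2 m1 z + m2) / 2, where m_k is
   the k-th moment of f''' on [a, b].  As f''' has constant sign s, the number
   s m0 is positive, the mean x = m1 / m0 lies strictly between a and b, and
   the variance m2 / m0 - x^2 is positive, so that the roots are x +- i y with
   y^2 this variance. *)
Require Import Defs.
From Stdlib Require Import Reals Ranalysis5 Lra Lia.
From Coquelicot Require Import Coquelicot.

Open Scope R_scope.

(** A sign change would force a zero by the intermediate value theorem, so [g a] serves as [s].
    Carrying the factor [s] along treats both signs of [g] at once. *)
Lemma nonzero_constant_sign (g : R -> R) (a b : R) :
  a < b ->
  (forall t, a <= t <= b -> continuous g t) ->
  (forall t, a <= t <= b -> g t <> 0) ->
  exists s : R, forall t, a <= t <= b -> 0 < s * g t.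
Proof.
intros hab hc hn.
exists (g a); intros t ht.
destruct (Rle_lt_dec (g a * g t) 0) as [hle|]; [exfalso|assumption].
pose proof (hn a ltac:(lra)) as ha; pose proof (hn t ht) as hgt.
assert (hat : a < t).
{ destruct (Req_dec a t) as [e|]; [subst t; nra|lra]. }
(* The factor [- (g a)] makes the function negative at [a] and positive at [t], the orientation that
   [IVT_interv] expects. *)
assert (hcont : forall c, a <= c <= t -> continuity_pt (fun u => - (g a) * g u) c).
{ intros c hcat; apply continuity_pt_filterlim.
  apply (continuous_scal_r (- g a) g), hc; lra. }
destruct (IVT_interv _ a t hcont hat) as [z [hz h0]]; [nra|nra|].
apply (hn z); [lra|nra].
Qed.

(** Positivity of [w] is asked only in the open interval, so that weights vanishing at an endpoint,
    such as [t - a] and [b - t], are covered. *)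
Lemma RInt_weighted_gt_0 (g w : R -> R) (s a b : R) :
  a < b ->
  (forall t, a <= t <= b -> continuous g t) ->
  (forall t, a <= t <= b -> 0 < s * g t) ->
  (forall t, continuous w t) ->
  (forall t, a < t < b -> 0 < w t) ->
  0 < s * RInt (fun t => g t * w t) a b.
Proof.
intros hab hc hs hw hwp.
assert (hcw : forall t, a <= t <= b -> continuous (fun u => g u * w u) t).
{ intros t ht; apply (continuous_mult g w); auto. }
replace (s * RInt (fun t => g t * w t) a b)
  with (RInt (fun t => s * (g t * w t)) a b).
2:{ apply (RInt_scal (fun t => g t * w t)), ex_RInt_continuous.
    intros z; rewrite Rmin_left, Rmax_right by lra; apply hcw. }
apply RInt_gt_0; [assumption| |].
- intros t ht; rewrite <- Rmult_assoc.
  apply Rmult_lt_0_compat; [apply hs; lra|auto].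
- intros t ht; apply (continuous_scal_r s (fun u => g u * w u)), hcw, ht.
Qed.

(** With [x = m1 / m0], the conclusions come from integrating the positive density [s * g] against
    the weights [1], [t - a], [b - t] and [(t - x) ^ 2], all of them quadratics in [t]. *)
Lemma mean_variance (g : R -> R) (s a b m0 m1 m2 : R) :
  a < b ->
  (forall t, a <= t <= b -> continuous g t) ->
  (forall t, a <= t <= b -> 0 < s * g t) ->
  is_RInt g a b m0 ->
  is_RInt (fun t => t * g t) a b m1 ->
  is_RInt (fun t => t ^ 2 * g t) a b m2 ->
  m0 <> 0 /\ a < m1 / m0 < b /\ 0 < m2 / m0 - (m1 / m0) ^ 2.
Proof.
intros hab hc hs h0 h1 h2.
assert (hquad : forall p q r,
  RInt (fun t => g t * (p * t ^ 2 + q * t + r)) a b = p * m2 + q * m1 + r * m0).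
{ intros p q r; apply is_RInt_unique.
  pose proof (is_RInt_plus _ _ _ _ _ _
    (is_RInt_plus _ _ _ _ _ _ (is_RInt_scal _ _ _ p _ h2)
       (is_RInt_scal _ _ _ q _ h1)) (is_RInt_scal _ _ _ r _ h0)) as h.
  refine (is_RInt_ext _ _ _ _ _ _ h).
  intros t _; unfold plus, scal; simpl; unfold mult; simpl; ring. }
assert (hcq : forall p q r t, continuous (fun u : R => p * u ^ 2 + q * u + r) t).
{ intros p q r t.
  apply (ex_derive_continuous (fun u : R => p * u ^ 2 + q * u + r)).
  auto_derive; trivial. }
assert (hpos : forall c d p q r, c < d -> a <= c -> d <= b ->
  (forall t, c < t < d -> 0 < p * t ^ 2 + q * t + r) ->
  0 < s * RInt (fun t => g t * (p * t ^ 2 + q * t + r)) c d).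
{ intros c d p q r hcd hac hdb hp.
  apply (RInt_weighted_gt_0 g (fun t => p * t ^ 2 + q * t + r)); auto;
    intros t ht; [apply hc|apply hs]; lra. }
(* The weights [1], [t - a] and [b - t] give in turn the positivity of [s * m0], [s * (m1 - a * m0)]
   and [s * (b * m0 - m1)]. *)
assert (p0 := hpos a b 0 0 1 hab (Rle_refl a) (Rle_refl b) ltac:(intros; lra)).
assert (pa := hpos a b 0 1 (- a) hab (Rle_refl a) (Rle_refl b) ltac:(intros; lra)).
assert (pb := hpos a b 0 (-1) b hab (Rle_refl a) (Rle_refl b) ltac:(intros; lra)).
rewrite hquad in p0, pa, pb.
assert (hm0 : m0 <> 0) by (intros ->; lra).
set (x := m1 / m0).
assert (hx : m1 = x * m0) by (unfold x; field; assumption).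
assert (hax : a < x < b) by (split; nra).
(* The weight (t - x)^2 vanishes at x, hence the splitting of the integral. *)
assert (hsq : forall t, t <> x -> 0 < 1 * t ^ 2 + - (2 * x) * t + x ^ 2).
{ intros t ht; replace (1 * t ^ 2 + - (2 * x) * t + x ^ 2) with (Rsqr (t - x))
    by (unfold Rsqr; ring).
  apply Rsqr_pos_lt; lra. }
assert (pl := hpos a x _ _ _ ltac:(lra) ltac:(lra) ltac:(lra)
  (fun t ht => hsq t ltac:(lra))).
assert (pr := hpos x b _ _ _ ltac:(lra) ltac:(lra) ltac:(lra)
  (fun t ht => hsq t ltac:(lra))).
assert (hex : forall c d, a <= c -> c <= d -> d <= b ->
  ex_RInt (fun t => g t * (1 * t ^ 2 + - (2 * x) * t + x ^ 2)) c d).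
{ intros c d h3 h4 h5; apply (@ex_RInt_continuous R_CompleteNormedModule).
  intros z; rewrite Rmin_left, Rmax_right by lra; intros hz.
  apply (continuous_mult g); [apply hc; lra|apply hcq]. }
assert (hch := RInt_Chasles _ a x b (hex a x ltac:(lra) ltac:(lra) ltac:(lra))
  (hex x b ltac:(lra) ltac:(lra) ltac:(lra))).
rewrite hquad in hch; unfold plus in hch; simpl in hch.
assert (pv : 0 < s * (m2 - x ^ 2 * m0)).
{ replace (m2 - x ^ 2 * m0) with (1 * m2 + - (2 * x) * m1 + x ^ 2 * m0)
    by (rewrite hx; ring).
  simpl; rewrite <- hch, Rmult_plus_distr_l; apply Rplus_lt_0_compat; assumption. }
repeat split; try lra.
(* The sign of [m0] is unknown; multiplying through by [s] makes numerator and denominator both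
   positive. *)
replace (m2 / m0 - x ^ 2) with ((s * (m2 - x ^ 2 * m0)) / (s * m0)).
- apply Rdiv_lt_0_compat; lra.
- field; split; [assumption|intros ->; lra].
Qed.

(** [F1] and [F2] are the antiderivatives of [t * f3 t] and [t ^ 2 * f3 t] found by repeated
    integration by parts. *)
Lemma is_RInt_moments (f0 f1 f2 f3 : R -> R) (a b : R) :
  a <= b ->
  (forall t, a <= t <= b -> is_derive f0 t (f1 t)) ->
  (forall t, a <= t <= b -> is_derive f1 t (f2 t)) ->
  (forall t, a <= t <= b -> is_derive f2 t (f3 t)) ->
  (forall t, a <= t <= b -> continuous f3 t) ->
  let F1 t := t * f2 t - f1 t in
  let F2 t := t ^ 2 * f2 t - 2 * t * f1 t + 2 * f0 t in
  is_RInt f3 a b (f2 b - f2 a) /\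
  is_RInt (fun t => t * f3 t) a b (F1 b - F1 a) /\
  is_RInt (fun t => t ^ 2 * f3 t) a b (F2 b - F2 a).
Proof.
intros hab d0 d1 d2 hc F1 F2.
assert (hcw : forall (w : R -> R) (t : R), ex_derive w t -> a <= t <= b ->
  continuous (fun u => w u * f3 u) t).
{ intros w t hw ht; apply (continuous_mult w f3); [|auto].
  now apply (ex_derive_continuous w). }
repeat split; apply (is_RInt_derive (V := R_CompleteNormedModule));
  rewrite Rmin_left, Rmax_right by assumption; intros t ht; auto.
- specialize (d1 t ht); specialize (d2 t ht); unfold F1.
  auto_derive; [repeat split; eexists; eassumption|].
  replace (Derive _ t) with (f3 t) by (symmetry; now apply is_derive_unique).
  replace (Derive _ t) with (f2 t) by (symmetry; now apply is_derive_unique).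
  ring.
- apply (hcw (fun u => u)); [auto_derive|]; trivial.
- specialize (d0 t ht); specialize (d1 t ht); specialize (d2 t ht); unfold F2.
  auto_derive; [repeat split; eexists; eassumption|].
  replace (Derive (fun x => f0 x) t) with (f1 t)
    by (symmetry; now apply is_derive_unique).
  replace (Derive (fun x => f1 x) t) with (f2 t)
    by (symmetry; now apply is_derive_unique).
  replace (Derive (fun x => f2 x) t) with (f3 t)
    by (symmetry; now apply is_derive_unique).
  ring.
- apply (hcw (fun u => u ^ 2)); [auto_derive|]; trivial.
Qed.

(** Expanding [2 * P_c(z)] in powers of [z] gives the coefficients [f''(c)], [-2 * F1 c] and [F2 c],
    with the same [F1] and [F2] as in [is_RInt_moments]. This identifies the coefficients of the
    difference with moments, without integrating a complex-valued function. *)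
Lemma taylor_poly_2_sub (f : R -> R) (a b : R) (z : C) :
  let F1 t := t * Derive_n f 2 t - Derive_n f 1 t in
  let F2 t := t ^ 2 * Derive_n f 2 t - 2 * t * Derive_n f 1 t + 2 * f t in
  (taylor_poly f 2 b z - taylor_poly f 2 a z)%C =
  (RtoC (/ 2) * (RtoC (Derive_n f 2 b - Derive_n f 2 a) * (z * z)
    - RtoC (2 * (F1 b - F1 a)) * z + RtoC (F2 b - F2 a)))%C.
Proof.
intros F1 F2; unfold F1, F2, taylor_poly.
rewrite !sum_Sn, !sum_O.
change (Derive_n f 0) with f.
(* The identity is purely algebraic: it holds for any three functions in place of [f] and its
   derivatives. *)
generalize (Derive_n f 1) (Derive_n f 2); intros f1 f2.
destruct z as [u v].
apply injective_projections; simpl; field.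
Qed.

(** The equations for [m1] and [m2] are the Vieta relations for the pair of roots, so the quadratic
    factors, and a product in [C] vanishes only if a factor does. *)
Lemma real_quadratic_roots (m0 m1 m2 x y : R) (z : C) :
  m0 <> 0 -> m1 = m0 * x -> m2 = m0 * (x ^ 2 + y ^ 2) ->
  (RtoC (/ 2) * (RtoC m0 * (z * z) - RtoC (2 * m1) * z + RtoC m2))%C = RtoC 0 <->
  (z = (RtoC x + Ci * RtoC y)%C \/ z = (RtoC x - Ci * RtoC y)%C).
Proof.
intros h0 -> ->.
replace (RtoC (/ 2) * (RtoC m0 * (z * z) - RtoC (2 * (m0 * x)) * z
    + RtoC (m0 * (x ^ 2 + y ^ 2))))%C
  with (RtoC (m0 / 2) * ((z - (RtoC x + Ci * RtoC y))
    * (z - (RtoC x - Ci * RtoC y))))%C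
  by (destruct z as [u v]; apply injective_projections; simpl; field).
assert (hm : RtoC (m0 / 2) <> RtoC 0) by (intros h; apply RtoC_inj in h; lra).
assert (hsub : forall v w : C, (v - w)%C = RtoC 0 -> v = w).
{ intros v w h; replace v with ((v - w) + w)%C by ring; rewrite h; ring. }
split.
- intros h.
  destruct (Ceq_dec (z - (RtoC x + Ci * RtoC y)) 0) as [e|n1]; [left; auto|].
  destruct (Ceq_dec (z - (RtoC x - Ci * RtoC y)) 0) as [e|n2]; [right; auto|].
  destruct (Cmult_neq_0 _ _ hm (Cmult_neq_0 _ _ n1 n2) h).
- intros [-> | ->]; ring.
Qed.

Theorem corollary1 (a b : R) (f : R -> R)
  (ha : 0 < a) (hab : a < b)
  (hf : exists l u : Rbar, Rbar_lt l a /\ Rbar_lt b u /\ C3_on f l u)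
  (hf3 : forall x : R, a <= x <= b -> Derive_n f 3 x <> 0) :
  (exists x1 y1 : R, y1 <> 0 /\
     forall z : C,
       (taylor_poly f 2 b z - taylor_poly f 2 a z)%C = RtoC 0 <->
       (z = (RtoC x1 + Ci * RtoC y1)%C \/ z = (RtoC x1 - Ci * RtoC y1)%C)) /\
  (forall x1 y1 : R, y1 <> 0 ->
     (forall z : C,
       (taylor_poly f 2 b z - taylor_poly f 2 a z)%C = RtoC 0 <->
       (z = (RtoC x1 + Ci * RtoC y1)%C \/ z = (RtoC x1 - Ci * RtoC y1)%C)) ->
     x1 = RInt (fun t : R => t * Derive_n f 3 t) a b / RInt (Derive_n f 3) a b /\
     a < x1 < b).
Proof.
destruct hf as [l [u [hl [hu hC]]]].
assert (hC3 : forall t, a <= t <= b ->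
  (forall k : nat, (k <= 3)%nat -> ex_derive_n f k t) /\
  continuous (Derive_n f 3) t).
{ intros t ht; apply hC.
  - apply Rbar_lt_le_trans with a; [exact hl|apply ht].
  - apply Rbar_le_lt_trans with b; [apply ht|exact hu]. }
assert (hc : forall t, a <= t <= b -> continuous (Derive_n f 3) t)
  by (intros t ht; now apply hC3).
assert (hd : forall k t, (k < 3)%nat -> a <= t <= b ->
  is_derive (Derive_n f k) t (Derive_n f (S k) t)).
(* By definition [ex_derive_n f (S k) t] is differentiability of [Derive_n f k] at [t]. *)
{ intros k t hk ht; apply Derive_correct, (proj1 (hC3 t ht) (S k)); lia. }
destruct (is_RInt_moments f (Derive_n f 1) (Derive_n f 2) (Derive_n f 3) a b)
  as [h0 [h1 h2]]; auto with real.
{ intros t ht; apply (hd 0%nat); [lia|assumption]. }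
pose proof (fun z => taylor_poly_2_sub f a b z) as hP; cbv zeta in hP.
destruct (nonzero_constant_sign _ a b hab hc hf3) as [s hs].
destruct (mean_variance _ s a b _ _ _ hab hc hs h0 h1 h2) as [hm0 [hx hv]].
rewrite (is_RInt_unique _ _ _ _ h0), (is_RInt_unique _ _ _ _ h1).
revert hm0 hx hv hP.
(* Only the relations between the three moments matter from here on, so they become variables [m0],
   [m1], [m2]; the two patterns below pick out the numerators of the mean and of [m2 / m0]. *)
generalize (Derive_n f 2 b - Derive_n f 2 a).
match goal with |- context [?p / _ < b] => generalize p end.
match goal with |- context [?p / _ - _] => generalize p end.
intros m2 m1 m0 hm0 hx hv hP.
set (y := sqrt (m2 / m0 - (m1 / m0) ^ 2)).
assert (hy : y <> 0) by (unfold y; apply Rgt_not_eq, sqrt_lt_R0, hv).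
assert (hroots : forall z : C,
  (taylor_poly f 2 b z - taylor_poly f 2 a z)%C = RtoC 0 <->
  (z = (RtoC (m1 / m0) + Ci * RtoC y)%C \/ z = (RtoC (m1 / m0) - Ci * RtoC y)%C)).
{ intros z; rewrite hP; apply real_quadratic_roots; [assumption|field; assumption|].
  unfold y; rewrite pow2_sqrt by lra; field; assumption. }
split.
- exists (m1 / m0), y; auto.
- intros x1 y1 _ hr.
  (* The root [x1 + i y1] must be one of [m1 / m0 + i y] and [m1 / m0 - i y], which have the same
     real part. *)
  assert (hre : x1 = m1 / m0).
  { destruct (proj1 (hroots _) (proj2 (hr _) (or_introl eq_refl))) as [e|e];
      apply (f_equal fst) in e; simpl in e; lra. }
  rewrite hre; auto.
Qed.
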